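(* The identity map $\iota_n:\mathrm{NC}(n)\rightarrow\mathrm{NC}(n)$ is pure in the cone $\mathcal{CP}(\mathrm{NC}(n))$ for every $n\geq2$.
   Context: $*_1^n\mathbb Z_2$ is the free product of $n$ copies of $\mathbb Z_2$, with canonical generators $v_1,\dots,v_n$ (one for each copy); $\mathrm C^*( *_1^n\mathbb Z_2)$ is its full group C$^*$-algebra, in which each $v_j$ is a selfadjoint unitary. $\mathrm{NC}(n)=\mathrm{Span}\{1,v_1,\dots,v_n\}\subset\mathrm C^*( *_1^n\mathbb Z_2)$, an operator system (unital selfadjoint subspace). For an operator system $\mathcal R$, $\mathcal{CP}(\mathcal R)$ is the convex cone of completely positive linear maps $\mathcal R\to\mathcal R$; $\phi$ is pure in this cone if, whenever $\vartheta,\omega\in\mathcal{CP}(\mathcal R)$ satisfy $\vartheta+\omega=\phi$, there is $s\in[0,1]$ with $\vartheta=s\phi$ and $\omega=(1-s)\phi$. *)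

(* Defs.v *)
From HB Require Import structures.
From mathcomp Require Import all_boot all_order all_algebra.
From mathcomp Require Import complex.
From mathcomp Require Import all_classical all_reals all_analysis.

Set Implicit Arguments.
Unset Strict Implicit.
Unset Printing Implicit Defensive.

Import Order.TTheory GRing.Theory Num.Theory.
Import numFieldNormedType.Exports.

Local Open Scope classical_set_scope.
Local Open Scope complex_scope.
Local Open Scope ring_scope.

(* The free product of n copies of Z_2.  As each factor has exactly one
   nontrivial element, a reduced word is a sequence of factor indices in which
   no two consecutive entries coincide. *)

Definition reduced (n : nat) (w : seq 'I_n) : bool :=
  sorted (fun i j => i != j) w.

Record freeProdZ2 (n : nat) := FreeProdZ2 {
  word :> seq 'I_n;
  word_reduced : reduced word
}.

Section FreeProductGroup.
Variable n : nat.
Implicit Types (i j : 'I_n) (s t w : seq 'I_n).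

HB.instance Definition _ := [isSub for @word n].
HB.instance Definition _ := [Choice of freeProdZ2 n by <:].

(* left multiplication of a reduced word by a single letter *)
Definition push i w := if w is j :: t then (if i == j then t else i :: w)
                       else [:: i].

Definition mulw s t := foldr push t s.

Lemma reduced_tail j t : reduced (j :: t) -> reduced t.
Proof. by case: t => //= k t /andP[]. Qed.

Lemma push_reduced i w : reduced w -> reduced (push i w).
Proof.
case: w => [//|j t] jt /=; case: eqVneq => [_|ij]; first exact: reduced_tail jt.
by rewrite /reduced /= ij.
Qed.

Lemma pushK i w : reduced w -> push i (push i w) = w.
Proof.
case: w => [|j t] /=; first by rewrite eqxx.
case: eqVneq => [->|ij _] /=; last by rewrite eqxx.
by case: t => [//|k t] /= /andP[/negbTE ->].
Qed.

Lemma mulw_reduced s t : reduced t -> reduced (mulw s t).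
Proof. by move=> ht; elim: s => //= i s; apply: push_reduced. Qed.

Lemma mulw_push i s t : reduced t -> mulw (push i s) t = push i (mulw s t).
Proof.
move=> ht; case: s => [//|j s] /=; case: eqVneq => [->|//].
by rewrite pushK // mulw_reduced.
Qed.

Lemma mulwA s t w : reduced w -> mulw s (mulw t w) = mulw (mulw s t) w.
Proof. by move=> hw; elim: s => //= i s ->; rewrite mulw_push. Qed.

Lemma mulw1 s : reduced s -> mulw s [::] = s.
Proof.
elim: s => //= i s IH h; rewrite IH ?(reduced_tail h)//.
by case: s h {IH} => //= j t /andP[/negbTE ->].
Qed.

Lemma rev_reduced s : reduced s -> reduced (rev s).
Proof.
rewrite /reduced rev_sorted; apply: sub_sorted => i j.
by rewrite /= eq_sym.
Qed.

Lemma mulVw s : reduced s -> mulw (rev s) s = [::].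
Proof.
elim: s => //= i s IH h; rewrite rev_cons -cats1 /mulw foldr_cat /= eqxx.
exact: IH (reduced_tail h).
Qed.

Definition fp1 : freeProdZ2 n := @FreeProdZ2 n [::] isT.
Definition fpM (x y : freeProdZ2 n) : freeProdZ2 n :=
  FreeProdZ2 (mulw_reduced x (word_reduced y)).
Definition fpV (x : freeProdZ2 n) : freeProdZ2 n :=
  FreeProdZ2 (rev_reduced (word_reduced x)).

Lemma fpMA : associative fpM.
Proof. by move=> x y z; apply: val_inj; rewrite /= mulwA ?word_reduced. Qed.
Lemma fp1M : left_id fp1 fpM.
Proof. by move=> x; apply: val_inj. Qed.
Lemma fpM1 : right_id fp1 fpM.
Proof. by move=> x; apply: val_inj; rewrite /= mulw1 ?word_reduced. Qed.
Lemma fpVM : left_inverse fp1 fpV fpM.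
Proof. by move=> x; apply: val_inj; rewrite /= mulVw ?word_reduced. Qed.
Lemma fpMV : right_inverse fp1 fpV fpM.
Proof.
move=> x; apply: val_inj => /=; rewrite -{1}[word x]revK mulVw //.
exact: rev_reduced (word_reduced x).
Qed.

HB.instance Definition _ := isGroup.Build (freeProdZ2 n) fpMA fp1M fpM1 fpVM fpMV.

Definition fp_gen (j : 'I_n) : freeProdZ2 n := @FreeProdZ2 n [:: j] isT.

Lemma fp_genV j : ((fp_gen j)^-1)%g = fp_gen j.
Proof. exact: val_inj. Qed.

End FreeProductGroup.

(* Norms in a normedModType over R[i] take values in R[i]; r%:C embeds R. *)

(* The inner product is linear in its first argument. *)
HB.mixin Record isHilbert (R : realType) H of CompleteNormedModule R[i] H := {
  dot : H -> H -> R[i];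
  dot_linear : forall (c : R[i]) (x y z : H),
    dot (c *: x + y) z = c * dot x z + dot y z;
  dot_conj : forall x y : H, dot y x = (dot x y)^*;
  dot_norm : forall x : H, dot x x = `|x| ^+ 2
}.

#[short(type="hilbertType")]
HB.structure Definition Hilbert (R : realType) :=
  {H of CompleteNormedModule R[i] H & isHilbert R H}.

(* Unital C*-algebras.  The norm is a field of its own because Hierarchy Builder
   rejects a common extension of algType and normedModType: numDomainType is
   already one, and no smaller structure is declared above both. *)
HB.mixin Record isCStarAlgebra (R : realType) A of GRing.Algebra R[i] A := {
  star : A -> A;
  cnorm : A -> R;
  starK : involutive star;
  star_conj_linear : forall (c : R[i]) (a b : A),
    star (c *: a + b) = c^* *: star a + star b;
  starM : forall a b : A, star (a * b) = star b * star a;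
  cnorm_eq0 : forall a : A, cnorm a = 0 -> a = 0;
  cnormD : forall a b : A, cnorm (a + b) <= cnorm a + cnorm b;
  cnormZ : forall (c : R[i]) (a : A), (cnorm (c *: a))%:C = `|c| * (cnorm a)%:C;
  cnormM : forall a b : A, cnorm (a * b) <= cnorm a * cnorm b;
  cnorm_starM : forall a : A, cnorm (star a * a) = cnorm a ^+ 2;
  cnorm_complete : forall f : nat -> A,
    (forall e : R, 0 < e -> exists N, forall p q,
       (N <= p)%N -> (N <= q)%N -> cnorm (f p - f q) < e) ->
    exists a : A, forall e : R, 0 < e -> exists N, forall p,
       (N <= p)%N -> cnorm (f p - a) < e
}.

#[short(type="cstarAlgType")]
HB.structure Definition CStarAlgebra (R : realType) :=
  {A of GRing.Algebra R[i] A & isCStarAlgebra R A}.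

Section FullGroupCstar.
Variables (R : realType) (G : groupType).

(* Each operator is invertible, since G is a group, so preserving the inner
   product makes it unitary. *)
Record unitaryRep (H : hilbertType R) := UnitaryRep {
  urep :> G -> {linear H -> H};
  urep1 : forall x, urep 1%g x = x;
  urepM : forall g h x, urep (g * h)%g x = urep g (urep h x);
  urep_dot : forall g x y, dot (urep g x) (urep g y) = dot x y
}.

(* Universal norm of the element \sum_(g <- s) c g g of the group algebra
   C[G]: the supremum of the operator norms of its images under all unitary
   representations of G. *)
Definition universal_norm (s : seq G) (c : G -> R[i]) : R :=
  sup [set r : R | exists (H : hilbertType R) (pi : unitaryRep H) (x : H),
         `|x| <= 1 /\ r%:C = `|\sum_(g <- s) c g *: pi g x| ].

(* The full group C*-algebra of G, i.e. the completion of C[G] in the universal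
   norm: a C*-algebra containing an isometric dense copy of the *-algebra C[G].
   As always for completions, it is determined up to isomorphism. *)
Record fullGroupCstar := FullGroupCstar {
  fgc_alg :> cstarAlgType R;
  fgc_unit : G -> fgc_alg;
  fgc_unit1 : fgc_unit 1%g = 1;
  fgc_unitM : forall g h, fgc_unit (g * h)%g = fgc_unit g * fgc_unit h;
  fgc_unitV : forall g, fgc_unit (g^-1)%g = star (fgc_unit g);
  fgc_norm : forall (s : seq G) (c : G -> R[i]),
    cnorm (\sum_(g <- s) c g *: fgc_unit g) = universal_norm s c;
  fgc_dense : forall (a : fgc_alg) (e : R), 0 < e ->
    exists (s : seq G) (c : G -> R[i]),
      cnorm (a - \sum_(g <- s) c g *: fgc_unit g) < e
}.

End FullGroupCstar.

Section OperatorSystems.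
Variables (R : realType) (A : cstarAlgType R).

Definition positive_mx (k : nat) (X : 'M[A]_k) : Prop :=
  exists Y : 'M[A]_k, X = (map_mx (@star R A) Y)^T *m Y.

Record opSystem := OpSystem {
  opsys_pred :> {pred A};
  opsys_submod : submod_closed opsys_pred;
  opsys_one : 1 \in opsys_pred;
  opsys_star : forall a, a \in opsys_pred -> star a \in opsys_pred
}.

Record opsys_elt (S : opSystem) := OpsysElt {
  opsys_val : A;
  opsys_valP : opsys_val \in S
}.

HB.instance Definition _ (S : opSystem) := [isSub for @opsys_val S].
HB.instance Definition _ (S : opSystem) := [Choice of opsys_elt S by <:].
HB.instance Definition _ (S : opSystem) :=
  GRing.SubChoice_isSubLmodule.Build R[i] A (opsys_pred S) (opsys_elt S)
    (opsys_submod S).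

(* M_k(S) is ordered as a subspace of M_k(A). *)
Definition completely_positive (S : opSystem)
    (phi : {linear opsys_elt S -> opsys_elt S}) : Prop :=
  forall (k : nat) (X : 'M[opsys_elt S]_k),
    positive_mx (map_mx (@opsys_val S) X) ->
    positive_mx (map_mx (@opsys_val S) (map_mx phi X)).

Definition pure_in_CP (S : opSystem)
    (phi : {linear opsys_elt S -> opsys_elt S}) : Prop :=
  completely_positive phi /\
  forall theta omega : {linear opsys_elt S -> opsys_elt S},
    completely_positive theta -> completely_positive omega ->
    (forall x, theta x + omega x = phi x) ->
    exists s : R, [/\ 0 <= s <= 1,
      (forall x, theta x = s%:C *: phi x) &
      (forall x, omega x = (1 - s)%:C *: phi x)].

End OperatorSystems.

Section NC.
Variables (R : realType) (n : nat) (A : fullGroupCstar R (freeProdZ2 n)).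

Definition NC_gen (j : 'I_n) : A := fgc_unit A (fp_gen j).

Definition NC_pred : {pred A} :=
  [pred a : A | `[< exists (c0 : R[i]) (c : 'I_n -> R[i]),
                     a = c0 *: 1 + \sum_(j < n) c j *: NC_gen j >]].

Lemma NC_submod : submod_closed NC_pred.
Proof.
split.
  apply/asboolP; exists 0, (fun=> 0); rewrite scale0r add0r big1 // => j _.
  by rewrite scale0r.
move=> z _ _ /asboolP[a0 [a ->]] /asboolP[b0 [b ->]]; apply/asboolP.
exists (z * a0 + b0), (fun j => z * a j + b j).
rewrite scalerDr scaler_sumr addrACA -big_split /= scalerDl scalerA.
by congr (_ + _); apply: eq_bigr => j _; rewrite scalerDl scalerA.
Qed.

Lemma NC_one : 1 \in NC_pred.
Proof.
apply/asboolP; exists 1, (fun=> 0); rewrite scale1r big1 ?addr0 // => j _.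
by rewrite scale0r.
Qed.

Lemma NC_star a : a \in NC_pred -> star a \in NC_pred.
Proof.
have starZ (c : R[i]) (b : A) : star (c *: b) = c^* *: star b.
  have star0 : star (0 : A) = 0.
    have := star_conj_linear 1 (0 : A) 0.
    by rewrite rmorph1 !scale1r addr0 => /(congr1 (fun y => y - star 0));
      rewrite subrr addrK => <-.
  by rewrite -[c *: b]addr0 star_conj_linear star0 addr0.
have starD (x y : A) : star (x + y) = star x + star y.
  by rewrite -{1}[x]scale1r star_conj_linear rmorph1 scale1r.
move=> /asboolP[a0 [b ->]]; apply/asboolP; exists (a0^*), (fun j => (b j)^*).
have star1 : star (1 : A) = 1.
  by rewrite -(fgc_unit1 A) -fgc_unitV invg1.
rewrite starD starZ star1; congr (_ + _).
elim/big_ind2: _ => [|x x' y y' <- <-|j _]; last 2 first.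
- by rewrite starD.
- by rewrite starZ /NC_gen -fgc_unitV fp_genV.
by have := starZ 0 1; rewrite conjC0 !scale0r.
Qed.

Definition NC : opSystem A := OpSystem NC_submod NC_one NC_star.

End NC.

(* Main.v *)
(* A sign vector e in {1,-1}^n induces a character chi_e of the free product
   with chi_e(v_j) = e_j.  Being a one-dimensional unitary representation, it is
   dominated by the universal norm on the group algebra, so it takes nonnegative
   values on the positive elements of A that lie in the group algebra.

   Suppose theta + omega = id.  As 1 + s v_j is positive for s = 1 and s = -1,
   0 <= theta(1 + s v_j) <= 1 + s v_j; chi_e kills the right-hand side for
   s = - e_j, whence chi_e(theta v_j) = e_j chi_e(theta 1).  Both
   p(e) = chi_e(theta 1) and e_j p(e) are therefore affine functions of the
   signs, for every j.  With at least two signs available this forces p to be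
   a constant c, and then theta = c id. *)

Require Import Defs.
From HB Require Import structures.
From mathcomp Require Import all_boot all_order all_algebra.
From mathcomp Require Import complex.
From mathcomp Require Import all_classical all_reals all_analysis.

Import Order.TTheory GRing.Theory Num.Theory.
Import numFieldNormedType.Exports.
Local Open Scope classical_set_scope.
Local Open Scope complex_scope.
Local Open Scope ring_scope.
Set Implicit Arguments.
Unset Strict Implicit.
Unset Printing Implicit Defensive.

(** * The complex numbers as a one-dimensional Hilbert space *)

Section ComplexLine.
Variable R : realType.
Local Notation Re := (@complex.Re R).
Local Notation Im := (@complex.Im R).

Definition complex_line : Type := ((R[i] : numFieldType)^o).
HB.instance Definition _ := NormedModule.copy complex_line ((R[i] : numFieldType)^o).

Lemma normc_ge_Im (z : R[i]) : `|Im z|%:C <= `|z|.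
Proof. by rewrite normc_def lecR -sqrtr_sqr ler_wsqrtr // lerDr sqr_ge0. Qed.

Lemma normc_le_ReIm (z : R[i]) : `|z| <= (`|Re z| + `|Im z|)%:C.
Proof.
rewrite normc_def lecR -[leRHS]ger0_norm ?addr_ge0 // -sqrtr_sqr ler_wsqrtr //.
by rewrite sqrrD !real_normK ?num_real // lerD2r lerDl mulrn_wge0 // mulr_ge0.
Qed.

(** The nonnegative reals are closed in the complex plane: [Re] and [Im] are contractions, and an
    approximant [p] has [Im p = 0] and [Re p >= 0]. *)
Lemma complex_ge0_approx (z : R[i]) :
  (forall e : R, 0 < e -> exists2 p : R[i], 0 <= p & `|z - p| <= e%:C) ->
  0 <= z.
Proof.
move=> zp; rewrite lecE; apply/andP; split.
  rewrite -normr_le0; apply/ler_addgt0Pr => e e0; rewrite add0r.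
  have [p p0 zpe] := zp _ e0; rewrite -lecR; apply: le_trans zpe.
  have := normc_ge_Im (z - p).
  by rewrite (raddfB (Im : Rcomplex R -> R)) /= (ger0_Im p0) subr0.
apply/ler_addgt0Pr => e e0; have [p p0 zpe] := zp _ e0.
have := le_trans (normc_ge_Re (z - p)) zpe.
rewrite lecR (raddfB (Re : Rcomplex R -> R)) /= ler_distl => /andP[h _].
rewrite -lerBlDr; apply: le_trans h; rewrite lerD2r.
by move: p0; rewrite lecE => /andP[].
Qed.

(** Both coordinates are contractions, so they send a Cauchy filter to Cauchy filters on [R]; the
    two real limits assemble to the complex one. *)
Lemma complex_line_complete (F : set_system complex_line) :
  ProperFilter F -> cauchy F -> cvg F.
Proof.
move=> FF /cauchyP Fc.
have coord_cvg (f : complex_line -> R) :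
    (forall x y, `|f x - f y|%:C <= `|x - y|) -> cvg (f @ F).
  move=> fle; apply/cauchy_cvgP/cauchyP => e e0.
  have [x Fx] := Fc e%:C (eqbRL (ltcR 0 e) e0).
  exists (f x); rewrite /= /nbhs /=.
  apply: filterS Fx => y; rewrite -!ball_normE /= => xy.
  by rewrite -ltcR; apply: le_lt_trans xy.
have /cvg_ex[a Fa] : cvg (Re @ F).
  by apply: coord_cvg => x y; rewrite -(raddfB (Re : Rcomplex R -> R)) normc_ge_Re.
have /cvg_ex[b Fb] : cvg (Im @ F).
  by apply: coord_cvg => x y; rewrite -(raddfB (Im : Rcomplex R -> R)) normc_ge_Im.
apply/cvg_ex; exists (a +i* b : complex_line); apply/cvgrPdist_le => e e0.
(* The radius lives in [R[i]], but being positive it is real. *)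
have eE : e = (complex.Re e)%:C by rewrite RRe_real // realE ltW.
move: e0; rewrite eE (ltcR 0) => e0.
near=> z.
apply: (le_trans (normc_le_ReIm _)); rewrite lecR [leRHS]splitr lerD //.
- rewrite (raddfB (Re : Rcomplex R -> R)) /=; near: z.
  by move/cvgrPdist_le: Fa; apply; rewrite divr_gt0.
- rewrite (raddfB (Im : Rcomplex R -> R)) /=; near: z.
  by move/cvgrPdist_le: Fb; apply; rewrite divr_gt0.
Unshelve. all: by end_near. Qed.

HB.instance Definition _ := Uniform_isComplete.Build complex_line complex_line_complete.

Definition line_dot (x y : complex_line) : R[i] := (x : R[i]) * (y : R[i])^*.

Lemma line_dot_linear (c : R[i]) (x y z : complex_line) :
  line_dot (c *: x + y) z = c * line_dot x z + line_dot y z.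
Proof. by rewrite /line_dot mulrDl -mulrA. Qed.

Lemma line_dot_conj (x y : complex_line) : line_dot y x = (line_dot x y)^*.
Proof.
suff conjE (z w : R[i]) : w * z^* = (z * w^*)^* by exact: conjE.
by rewrite rmorphM /= conjCK mulrC.
Qed.

Lemma line_dot_norm (x : complex_line) : line_dot x x = `|x| ^+ 2.
Proof. by rewrite normCK. Qed.

HB.instance Definition _ := isHilbert.Build R complex_line
  line_dot_linear line_dot_conj line_dot_norm.

End ComplexLine.

(** * Characters as one-dimensional unitary representations *)

Lemma urep_norm (R : realType) (G : groupType) (H : hilbertType R)
    (pi : unitaryRep G H) g x : `|pi g x| = `|x|.
Proof. by apply/eqP; rewrite -(@eqrXn2 _ 2)// -!dot_norm urep_dot. Qed.

Section CharacterRepresentation.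
Variables (R : realType) (G : groupType) (chi : G -> R[i]).
Hypothesis chi1 : chi 1%g = 1.
Hypothesis chiM : forall g h, chi (g * h)%g = chi g * chi h.
Hypothesis chi_norm : forall g, `|chi g| = 1.

Definition char_op (g : G) : {linear complex_line R -> complex_line R} :=
  GRing.scale (chi g).

Lemma char_op1 x : char_op 1%g x = x.
Proof. by rewrite /= chi1 scale1r. Qed.

Lemma char_opM g h x : char_op (g * h)%g x = char_op g (char_op h x).
Proof. by rewrite /= chiM scalerA. Qed.

Lemma char_op_dot g x y : dot (char_op g x) (char_op g y) = dot x y.
Proof.
suff dotE (a z w : R[i]) : `|a| = 1 -> (a * z) * (a * w)^* = z * w^*.
  exact: dotE.
by move=> a1; rewrite rmorphM mulrACA -normCK a1 expr1n mul1r.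
Qed.

Definition char_rep := UnitaryRep char_op1 char_opM char_op_dot.

(** The left-hand side is a member of the set whose supremum is the universal norm: take [char_rep]
    and the unit vector 1. *)
Lemma char_le_universal_norm (s : seq G) (c : G -> R[i]) :
  `|\sum_(g <- s) c g * chi g| <= (universal_norm s c)%:C.
Proof.
set z := \sum_(g <- s) _.
have zE : `|z| = (complex.Re `|z|)%:C by rewrite RRe_real // realE normr_ge0.
rewrite zE lecR; apply: sup_ubound; last first.
  exists (complex_line R), char_rep, (1 : R[i]); split; first by rewrite normr1.
  rewrite -zE; congr (`| _ |); apply: eq_bigr => g _.
  by rewrite /= -[LHS]mulr1 -mulrA.
(* The supremum bounds its set only if the set is bounded above; unitaries being isometric, the
   l1-norm of the coefficients is a bound. *)
exists (complex.Re (\sum_(g <- s) `|c g|)) => r [H [pi [x [x1 rE]]]].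
have sR : (complex.Re (\sum_(g <- s) `|c g|))%:C = \sum_(g <- s) `|c g|.
  by rewrite RRe_real // realE sumr_ge0.
rewrite -lecR rE sR; apply: le_trans (ler_norm_sum _ _ _) _.
by apply: ler_sum => g _; rewrite normrZ urep_norm ler_piMr.
Qed.

End CharacterRepresentation.

(** * Involution, norm and positivity in a C*-algebra *)

Section CStarAlgebraTheory.
Variables (R : realType) (A : cstarAlgType R).
Implicit Types (a b : A).

Lemma starD a b : star (a + b) = star a + star b.
Proof. by rewrite -{1}[a]scale1r star_conj_linear rmorph1 scale1r. Qed.

Lemma star0 : star (0 : A) = 0.
Proof. by apply: (addrI (star (0 : A))); rewrite -starD !addr0. Qed.

Lemma starZ (c : R[i]) a : star (c *: a) = c^* *: star a.
Proof. by rewrite -[c *: a]addr0 star_conj_linear star0 addr0. Qed.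

Lemma star1 : star (1 : A) = 1.
Proof. by rewrite -[LHS]mulr1 -{2}[1]starK -starM mulr1 starK. Qed.

Lemma cnorm_ge0 a : 0 <= cnorm a.
Proof.
have n0 : cnorm (0 : A) = 0.
  by apply: (@complexI R); rewrite -(scale0r (0 : A)) cnormZ normr0 mul0r.
have nN : cnorm (- a) = cnorm a.
  by apply: (@complexI R); rewrite -scaleN1r cnormZ normrN1 mul1r.
have := cnormD a (- a); rewrite subrr n0 nN => h.
by rewrite -(@pmulrn_lge0 _ _ 2)// mulr2n.
Qed.

(** The C*-identity and submultiplicativity bound [cnorm b ^+ 2] by [cnorm (star b) * cnorm b];
    cancel [cnorm b], then use the result for [a] and for [star a]. *)
Lemma cnorm_star a : cnorm (star a) = cnorm a.
Proof.
have le_star b : cnorm b <= cnorm (star b).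
  have [->|b0] := eqVneq (cnorm b) 0; first exact: cnorm_ge0.
  rewrite -(@ler_pM2r _ (cnorm b)) ?lt_def ?b0 ?cnorm_ge0 //.
  by rewrite -expr2 -cnorm_starM cnormM.
by apply: le_anti; rewrite le_star -{2}[a]starK le_star.
Qed.

Definition positive_elt a := exists b, a = star b * b.

Lemma positive_mx11 a : positive_mx (const_mx a : 'M[A]_1) <-> positive_elt a.
Proof.
split=> [[Y /matrixP /(_ 0 0)]|[b ->]].
  rewrite mxE => ->; exists (Y 0 0).
  by rewrite mxE big_ord1 !mxE.
exists (const_mx b); apply/matrixP => i j.
by rewrite !mxE big_ord1 !mxE.
Qed.

Lemma completely_positive_elt (S : opSystem A)
    (phi : {linear opsys_elt S -> opsys_elt S}) (x : opsys_elt S) :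
  completely_positive phi -> positive_elt (val x) -> positive_elt (val (phi x)).
Proof.
move=> cp /positive_mx11 x0; apply/positive_mx11.
by have := cp 1 (const_mx x); rewrite !map_const_mx; apply.
Qed.

End CStarAlgebraTheory.

(** * Evaluating a character on the group algebra inside the full C*-algebra *)

Section CharacterEvaluation.
Variables (R : realType) (G : groupType) (A : fullGroupCstar R G).
Variable chi : G -> R[i].
Hypothesis chi1 : chi 1%g = 1.
Hypothesis chiM : forall g h, chi (g * h)%g = chi g * chi h.
Hypothesis chi_norm : forall g, `|chi g| = 1.

Lemma chiV g : chi (g^-1)%g = (chi g)^*.
Proof.
have gN0 : chi g != 0 by rewrite -normr_eq0 chi_norm oner_eq0.
by apply: (mulfI gN0); rewrite -chiM mulgV chi1 -normCK chi_norm expr1n.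
Qed.

(* A relation rather than a map: that G is linearly independent in A, hence that
   chi extends to its span, is never needed. *)
Inductive char_ev : A -> R[i] -> Prop :=
| char_ev0 : char_ev 0 0
| char_ev_cons c g a z : char_ev a z ->
    char_ev (c *: fgc_unit A g + a) (c * chi g + z).

Lemma char_evD a b z w : char_ev a z -> char_ev b w -> char_ev (a + b) (z + w).
Proof.
move=> az bw; elim: az => [|c g a' z' _ IH]; first by rewrite !add0r.
by rewrite -!addrA; apply: char_ev_cons.
Qed.

Lemma char_evZ c a z : char_ev a z -> char_ev (c *: a) (c * z).
Proof.
elim=> [|d g a' z' _ IH]; first by rewrite scaler0 mulr0; apply: char_ev0.
by rewrite scalerDr mulrDr scalerA mulrA; apply: char_ev_cons.
Qed.

Lemma char_evB a b z w : char_ev a z -> char_ev b w -> char_ev (a - b) (z - w).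
Proof.
by move=> az bw; rewrite -scaleN1r -[- w]mulN1r; apply: char_evD (char_evZ _ _).
Qed.

Lemma char_ev_unit g : char_ev (fgc_unit A g) (chi g).
Proof.
by have := char_ev_cons 1 g char_ev0; rewrite scale1r mul1r !addr0.
Qed.

Lemma char_ev1 : char_ev 1 1.
Proof. by rewrite -(fgc_unit1 A) -chi1; apply: char_ev_unit. Qed.

Lemma char_ev_sum (I : Type) (r : seq I) (f : I -> A) (z : I -> R[i]) :
  (forall i, char_ev (f i) (z i)) ->
  char_ev (\sum_(i <- r) f i) (\sum_(i <- r) z i).
Proof.
by move=> fz; elim/big_ind2: _ => // [|*]; [exact: char_ev0|exact: char_evD].
Qed.

Lemma char_evM a b z w : char_ev a z -> char_ev b w -> char_ev (a * b) (z * w).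
Proof.
move=> az bw; elim: az => [|c g a' z' _ IH].
  by rewrite !mul0r; apply: char_ev0.
rewrite !mulrDl; apply: char_evD IH.
rewrite -scalerAl -mulrA; apply: char_evZ.
elim: bw => [|d h b' w' _ IHb]; first by rewrite !mulr0; apply: char_ev0.
rewrite !mulrDr mulrCA -scalerAr -chiM -fgc_unitM; exact: char_ev_cons.
Qed.

Lemma char_ev_star a z : char_ev a z -> char_ev (star a) z^*.
Proof.
elim=> [|c g a' z' _ IH]; first by rewrite star0 rmorph0; apply: char_ev0.
rewrite starD starZ rmorphD rmorphM /= -chiV -fgc_unitV; exact: char_ev_cons.
Qed.

Lemma char_ev_norm a z : char_ev a z -> `|z| <= (cnorm a)%:C.
Proof.
(* A derivation of [char_ev] may use a group element several times, whereas the universal norm takes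
   one coefficient per element, so equal elements are merged first. *)
have collect (V : lmodType R[i]) (f : G -> V) (l : seq (R[i] * G)) :
    \sum_(p <- l) p.1 *: f p.2 = \sum_(g <- undup [seq p.2 | p <- l])
      (\sum_(p <- l | p.2 == g) p.1) *: f g.
  under [RHS]eq_bigr do rewrite scaler_suml big_mkcond.
  rewrite exchange_big big_seq [RHS]big_seq; apply: eq_bigr => p pl.
  rewrite (bigD1_seq p.2) ?undup_uniq ?mem_undup ?map_f //= eqxx.
  by rewrite big1 ?addr0 // => g; rewrite eq_sym => /negbTE ->.
have terms : char_ev a z -> exists l : seq (R[i] * G),
    a = \sum_(p <- l) p.1 *: fgc_unit A p.2 /\
    z = \sum_(p <- l) p.1 *: (chi p.2 : R[i]^o).
  elim=> [|c g a' z' _ [l [-> ->]]]; first by exists [::]; rewrite !big_nil.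
  by exists ((c, g) :: l); rewrite !big_cons.
move=> /terms[l [-> ->]]; rewrite !collect fgc_norm.
exact: (char_le_universal_norm chi1 chiM chi_norm).
Qed.

(** The root [b] of [a = star b * b] need not lie in the group algebra. Density gives a nearby [y]
    that does; [star y * y] evaluates to a squared modulus, and contractivity of the evaluation
    keeps [z] close to it. *)
Lemma char_ev_ge0 a z : positive_elt a -> char_ev a z -> 0 <= z.
Proof.
move=> [b ->] bz; apply: complex_ge0_approx => d d0.
have K0 : 0 < cnorm b *+ 2 + 1 by rewrite ltr_wpDl // mulrn_wge0 ?cnorm_ge0.
(* If [y] is within [e] of [b], then [star y * y] is within [e * (cnorm b *+ 2 + e)] of [a]; this
   [e] makes that at most [d]. *)
pose e := Num.min 1 (d / (cnorm b *+ 2 + 1)).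
have e0 : 0 < e by rewrite lt_min ltr01 divr_gt0.
have e_small : e * (cnorm b *+ 2 + e) <= d.
  apply: (@le_trans _ _ (e * (cnorm b *+ 2 + 1))).
    by rewrite ler_wpM2l ?(ltW e0) // lerD2l ge_min lexx.
  by rewrite -ler_pdivlMr // ge_min lexx orbT.
have [s [c]] := fgc_dense b e0; set y := \sum_(g <- s) _ => by_lt.
have yw : char_ev y (\sum_(g <- s) c g * chi g).
  by apply: char_ev_sum => g; apply: char_evZ (char_ev_unit g).
set w := \sum_(g <- s) _ in yw; exists (w^* * w).
  by rewrite mulrC -normCK exprn_ge0.
have := char_ev_norm (char_evB bz (char_evM (char_ev_star yw) yw)).
move=> /le_trans; apply; rewrite lecR; apply: le_trans e_small.
have -> : star b * b - star y * y = star b * (b - y) + star (b - y) * y.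
  rewrite -[in star (b - y)]scaleN1r starD starZ rmorphN1 scaleN1r.
  by rewrite mulrBr mulrBl addrA subrK.
have yn : cnorm y <= cnorm b + e.
  have -> : y = b + (-1) *: (b - y) by rewrite scaleN1r opprB addrC subrK.
  apply: le_trans (cnormD _ _) _; rewrite lerD2l -lecR cnormZ normrN1 mul1r.
  by rewrite lecR ltW.
apply: le_trans (cnormD _ _) _.
rewrite mulr2n -addrA [leRHS]mulrDr lerD //; apply: le_trans (cnormM _ _) _.
  by rewrite cnorm_star mulrC ler_wpM2r ?cnorm_ge0 // ltW.
by rewrite cnorm_star ler_pM ?cnorm_ge0 // ltW.
Qed.

End CharacterEvaluation.

(** * Sign characters of the free product and affine functions of signs *)

Section SignCharacters.
Variables (R : realType) (n : nat).
Implicit Types (e : 'I_n -> bool) (c d : 'I_n -> R[i]).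

Definition sign_char e (g : freeProdZ2 n) : R[i] := \prod_(i <- word g) (-1) ^+ e i.

Lemma sign_char1 e : sign_char e 1%g = 1.
Proof. exact: big_nil. Qed.

(** Reduction only cancels pairs of equal letters, and such a pair contributes a squared sign, which
    is 1. *)
Lemma sign_charM e g h : sign_char e (g * h)%g = sign_char e g * sign_char e h.
Proof.
rewrite /sign_char /=; elim: (word g) => [|i s IH] /=; first by rewrite big_nil mul1r.
rewrite big_cons -mulrA -IH; case: (mulw s _) => [|j t] /=; rewrite ?big_cons //.
case: eqVneq => [->|_]; last by rewrite !big_cons.
by rewrite mulrA -signr_addb addbb expr0 mul1r.
Qed.

Lemma sign_char_norm e g : `|sign_char e g| = 1.
Proof. by rewrite normr_prod big1 // => i _; rewrite normr_sign. Qed.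

Lemma sign_char_gen e j : sign_char e (fp_gen j) = (-1) ^+ e j.
Proof. exact: big_seq1. Qed.

(** The value of the character of [e] at the element of [NC] with coefficients [c0] and [c]; [true]
    encodes the sign -1. *)
Definition affine_sign (c0 : R[i]) c e : R[i] := c0 + \sum_j c j * (-1) ^+ e j.

(** A discrete derivative: flipping one sign isolates its coefficient. *)
Lemma affine_sign_flip (c0 : R[i]) c e i :
  affine_sign c0 c [eta e with i |-> false] -
  affine_sign c0 c [eta e with i |-> true] = c i *+ 2.
Proof.
rewrite /affine_sign opprD addrACA subrr add0r (bigD1 i) //= eqxx.
rewrite [X in _ - X](bigD1 i) //= eqxx opprD addrACA.
rewrite [X in _ + (_ - X)](eq_bigr (fun j => c j * (-1) ^+ [eta e with i |-> false] j)).
  by rewrite subrr addr0 expr1 expr0 mulrN opprK mulr1 mulr2n.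
by move=> j /negbTE /= ->.
Qed.

Lemma affine_sign_inj (c0 d0 : R[i]) c d : affine_sign c0 c =1 affine_sign d0 d ->
  c0 = d0 /\ c =1 d.
Proof.
move=> cd; have cdE : c =1 d.
  move=> i; apply: (@pmulrnI _ 2) => //.
  by rewrite -(affine_sign_flip c0 c xpred0) -(affine_sign_flip d0 d xpred0) !cd.
split=> //; have := cd xpred0; rewrite /affine_sign.
by under eq_bigr do rewrite cdE; apply: addIr.
Qed.

(* If p and s_j p are both affine then, comparing the coefficients of
   s_i s_j, p does not depend on s_i for i != j. *)
Lemma affine_sign_twist (c0 d0 : R[i]) c d i j : i != j ->
  (forall e, affine_sign d0 d e = (-1) ^+ e j * affine_sign c0 c e) -> c i = 0.
Proof.
move=> ij cd; have flip (b : bool) : d i *+ 2 = (-1) ^+ b * (c i *+ 2).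
  pose e := [eta xpred0 with j |-> b].
  rewrite -(affine_sign_flip d0 d e) -(affine_sign_flip c0 c e) !cd /=.
  by rewrite eq_sym (negbTE ij) eqxx mulrBr.
have := flip true; rewrite (flip false) expr0 expr1 mul1r mulN1r => /eqP.
by rewrite -addr_eq0 -mulrnDr mulrn_eq0 => /eqP.
Qed.

End SignCharacters.

(** * Coordinates, sign evaluations and positive elements in [NC] *)

Section NCSystem.
Variables (R : realType) (n : nat) (A : fullGroupCstar R (freeProdZ2 n)).
Implicit Types (e : 'I_n -> bool) (x : opsys_elt (NC A)).

Definition sign_ev e : A -> R[i] -> Prop := char_ev (sign_char R e).

Lemma sign_ev_ge0 e a z : positive_elt a -> sign_ev e a z -> 0 <= z.
Proof.
exact: (char_ev_ge0 (sign_char1 _ e) (sign_charM _ e) (sign_char_norm _ e)).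
Qed.

Lemma NC_gen_in j : NC_gen A j \in NC A.
Proof.
apply/asboolP; exists 0, (fun i => (i == j)%:R).
rewrite scale0r add0r (bigD1 j) //= eqxx scale1r big1 ?addr0 // => i /negbTE ->.
by rewrite scale0r.
Qed.

Definition nc_one : opsys_elt (NC A) := OpsysElt (opsys_one (NC A)).
Definition nc_gen j : opsys_elt (NC A) := OpsysElt (NC_gen_in j).

Lemma val_span (c0 : R[i]) (c : 'I_n -> R[i]) :
  val (c0 *: nc_one + \sum_j c j *: nc_gen j) =
  c0 *: 1 + \sum_j c j *: NC_gen A j.
Proof.
by rewrite linearD linear_sum linearZ.
Qed.

Lemma nc_span x : exists c0 c, x = c0 *: nc_one + \sum_j c j *: nc_gen j.
Proof.
have /asboolP[c0 [c xE]] := opsys_valP x; exists c0, c.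
by apply: val_inj; rewrite val_span -xE.
Qed.

Lemma sign_ev1 e : sign_ev e (val nc_one) 1.
Proof. exact/char_ev1/sign_char1. Qed.

Lemma sign_ev_gen e j : sign_ev e (val (nc_gen j)) ((-1) ^+ e j).
Proof. by rewrite -(sign_char_gen R); apply: char_ev_unit. Qed.

Lemma sign_ev_span e c0 c :
  sign_ev e (val (c0 *: nc_one + \sum_j c j *: nc_gen j)) (affine_sign c0 c e).
Proof.
rewrite val_span; apply: char_evD.
  by rewrite -[c0 in X in char_ev _ _ X]mulr1; apply/char_evZ/sign_ev1.
apply: char_ev_sum => j; exact/char_evZ/sign_ev_gen.
Qed.

(** For a selfadjoint unitary [u], the square of [1 + u] is [2 (1 + u)]; the factor 2 makes [1 + u]
    itself the required root. *)
Lemma gen_positive j (b : bool) :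
  positive_elt (val (2 *: (nc_one + (-1) ^+ b *: nc_gen j))).
Proof.
set a := _ + _; have genV : star (NC_gen A j) = NC_gen A j.
  by rewrite /NC_gen -fgc_unitV fp_genV.
have gen2 : NC_gen A j * NC_gen A j = 1.
  by rewrite /NC_gen -fgc_unitM -fgc_unit1 -{1}(fp_genV j) mulVg.
exists (val a); rewrite linearZ linearD linearZ /=.
rewrite starD starZ genV star1 rmorph_sign mulrDl !mulrDr !mulr1 mul1r.
rewrite -scalerAl -scalerAr gen2 scalerA -signr_addb addbb expr0 scale1r.
by rewrite scaler_nat mulr2n [_ *: _ + 1]addrC.
Qed.

Lemma one_positive : positive_elt (val nc_one).
Proof. by exists 1; rewrite star1 mulr1. Qed.

End NCSystem.

(** * Purity of the identity *)

Theorem theorem5p2 (R : realType) (n : nat) (hn : (2 <= n)%N)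
    (A : fullGroupCstar R (freeProdZ2 n)) :
  pure_in_CP (S := NC A) idfun.
Proof.
split=> [k X|theta omega cp_theta cp_omega sum_id].
  by rewrite (_ : map_mx idfun X = X) //; apply/matrixP => i j; rewrite mxE.
have omegaE x : omega x = x - theta x.
  by apply: (addrI (theta x)); rewrite sum_id addrC subrK.
have [c0 [c one_im]] := nc_span (theta (nc_one A)).
have theta_bounds e x (z w : R[i]) :
    positive_elt (val x) -> sign_ev e (val x) z ->
    sign_ev e (val (theta x)) w -> 0 <= w <= z.
  move=> x0 xz xw; apply/andP; split.
    exact: sign_ev_ge0 (completely_positive_elt cp_theta x0) xw.
  rewrite -subr_ge0.
  apply: (sign_ev_ge0 (e := e)) (completely_positive_elt cp_omega x0) _.
  by rewrite omegaE linearB; apply: char_evB xz xw.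
have one_ev e : sign_ev e (val (theta (nc_one A))) (affine_sign c0 c e).
  by rewrite one_im; apply: sign_ev_span.
have gen_ev j : exists d0 d, theta (nc_gen A j) =
      d0 *: nc_one A + \sum_i d i *: nc_gen A i /\
    forall e, affine_sign d0 d e = (-1) ^+ e j * affine_sign c0 c e.
  have [d0 [d gen_im]] := nc_span (theta (nc_gen A j)).
  exists d0, d; split=> // e; set p := affine_sign c0 c e.
  set q := affine_sign d0 d e; set s : R[i] := (-1) ^+ e j.
  have q_ev : sign_ev e (val (theta (nc_gen A j))) q.
    by rewrite gen_im; apply: sign_ev_span.
  (* The opposite sign [~~ e j] is chosen so that the upper bound [2 * (1 - s * s)] vanishes, which
     forces [p = s * q]. *)
  have /(theta_bounds e _ (2 * (1 + - s * s)) (2 * (p + - s * q))) :=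
    gen_positive A j (~~ e j).
  rewrite signrN !linearZ !linearD !linearZ => bounds.
  have {bounds} : 0 <= 2 * (p + - s * q) <= 2 * (1 + - s * s).
    apply: bounds; apply: char_evZ; apply: char_evD.
    - exact: sign_ev1.
    - exact/char_evZ/sign_ev_gen.
    - exact: one_ev.
    - exact: char_evZ.
  have ss : s * s = 1 by rewrite -signr_addb addbb.
  rewrite !mulNr ss subrr mulr0 => /le_anti/esym/eqP.
  rewrite mulf_eq0 pnatr_eq0 /= subr_eq0 => /eqP ->.
  by rewrite mulrA ss mul1r.
have c_eq0 i : c i = 0.
  (* Here [2 <= n] supplies a second generator, whose twist removes the coefficient of [i]. *)
  have [j ji] : exists j, i != j.
    pose j0 := Ordinal (ltnW hn); pose j1 := Ordinal hn.
    by have [->|] := eqVneq i j0; [exists j1|exists j0].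
  by have [d0 [d [_ /(affine_sign_twist ji)]]] := gen_ev j.
have pE e : affine_sign c0 c e = c0.
  by rewrite /affine_sign big1 ?addr0 // => i _; rewrite c_eq0 mul0r.
have theta_one : theta (nc_one A) = c0 *: nc_one A.
  by rewrite one_im big1 ?addr0 // => i _; rewrite c_eq0 scale0r.
have theta_gen j : theta (nc_gen A j) = c0 *: nc_gen A j.
  have [d0 [d [-> dE]]] := gen_ev j.
  (* With [p] constant, the image of the generator evaluates to [c0] times the sign of [j]; an
     affine function of the signs determines its coefficients. *)
  have [-> dc] : d0 = 0 /\ d =1 (fun i => if i == j then c0 else 0).
    apply: affine_sign_inj => e; rewrite dE pE /affine_sign add0r (bigD1 j) //=.
    by rewrite eqxx big1 ?addr0 1?mulrC // => i /negbTE ->; rewrite mul0r.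
  rewrite scale0r add0r (bigD1 j) //= dc eqxx big1 ?addr0 // => i /negbTE ij.
  by rewrite dc ij scale0r.
have thetaE x : theta x = c0 *: x.
  have [a0 [a ->]] := nc_span x.
  rewrite linearD linearZ_LR linear_sum theta_one scalerDr scaler_sumr.
  congr (_ + _); first by rewrite !scalerA mulrC.
  by apply: eq_bigr => j _; rewrite linearZ_LR theta_gen !scalerA mulrC.
have /andP[c0_ge0 c0_le1] : 0 <= c0 <= 1.
  have := theta_bounds xpred0 _ _ _ (one_positive A) (sign_ev1 _ _) (one_ev _).
  by rewrite pE.
(* Nonnegativity in [R[i]] includes being real, so the scalar [s] can be the real part of [c0]. *)
have c0E : c0 = (complex.Re c0)%:C by rewrite RRe_real // realE c0_ge0.
have c0B : (1 - complex.Re c0)%:C = 1 - c0 by rewrite [in RHS]c0E rmorphB.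
exists (complex.Re c0); rewrite c0B -c0E; split=> // [|x].
  by rewrite -(lecR 0) -(lecR _ 1) -c0E c0_ge0.
by rewrite omegaE thetaE scalerBl scale1r.
Qed.
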